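(* Let $X$ be a space and let $\mathfrak{P}$ be a closed hereditary topological property preserved under finite closed sums. Then \[C^\mathfrak{P}_{00}(X)=\big\{f\in C_b(X):\mathrm{supp}(f)\text{ has a closed neighborhood in }X\text{ with }\mathfrak{P}\big\},\] and in particular, \[C^\mathfrak{P}_{00}(X)=\big\{f\in C_b(X):\mathrm{supp}(f)\text{ has a neighborhood in }X\text{ with }\mathfrak{P}\big\}\] if $X$ is normal. Furthermore: (1) $C^\mathfrak{P}_{00}(X)$ is an ideal in $C_b(X)$. (2) Let $X$ be completely regular. Then $C^\mathfrak{P}_{00}(X)$ is of empty hull if and only if $X$ is locally-$\mathfrak{P}$. (3) Let $X$ be completely regular and locally-$\mathfrak{P}$. Then $C^\mathfrak{P}_{00}(X)$ is unital if and only if $X$ has $\mathfrak{P}$. (4) Let $X$ be normal and locally-$\mathfrak{P}$. Then $C^\mathfrak{P}_{00}(X)$ is a normed algebra isometrically isomorphic to $C_{00}(Y)$ for some unique (up to homeomorphism) locally compact Hausdorff space $Y$, namely $Y=\lambda_\mathfrak{P}X$. Furthermore, $X$ is dense in $Y$ (in particular $X\subseteq Y$); and $C^\mathfrak{P}_{00}(X)$ is unital if and only if $X$ has $\mathfrak{P}$ if and only if $Y$ is compact.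
   Context: A space is a topological space; completely regular spaces and normal spaces are taken to be Hausdorff, and $\beta X$ is the Stone–Čech compactification of $X$, containing $X$ as a dense subspace. $C_b(X)$ is the normed algebra of continuous bounded $f:X\to\mathbb{R}$ with pointwise operations and the supremum norm; $\mathrm{coz}(f)=X\setminus f^{-1}(0)$, $\mathrm{supp}(f)=\mathrm{cl}_X\mathrm{coz}(f)$, and $\mathrm{Coz}(X)$ is the set of all cozero-sets of continuous real-valued functions on $X$. $C_{00}(Y)$ is the set of continuous bounded $f:Y\to\mathbb{R}$ with compact support. A neighborhood of a set $A$ in $X$ is a set $U\subseteq X$ with $A\subseteq\mathrm{int}_XU$. A topological property $\mathfrak{P}$ is closed hereditary if every closed subspace of a space with $\mathfrak{P}$ has $\mathfrak{P}$; it is preserved under finite closed sums if every space which is a finite union of closed subspaces each having $\mathfrak{P}$ has $\mathfrak{P}$. A space is locally-$\mathfrak{P}$ if each of its points has a neighborhood (in the space) with $\mathfrak{P}$. $\mathscr{I}_\mathfrak{P}=\{A\subseteq X:\mathrm{cl}_XA\text{ has }\mathfrak{P}\}$; its elements are called null. $C^\mathfrak{P}_{00}(X)=\{f\in C_b(X):\mathrm{supp}(f)\text{ has a null neighborhood in }X\}$, i.e. $\mathrm{supp}(f)\subseteq\mathrm{int}_XU$ for some $U\in\mathscr{I}_\mathfrak{P}$. $\lambda_\mathfrak{P}X=\bigcup\{\mathrm{int}_{\beta X}\mathrm{cl}_{\beta X}C:C\in\mathrm{Coz}(X)\text{ and }\mathrm{cl}_XC\text{ has a null neighborhood in }X\}$,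 considered as a subspace of $\beta X$. An ideal $H$ of $C_b(X)$ is of empty hull if for every $x\in X$ there is $h\in H$ with $h(x)\neq0$. An algebra is unital if it has a multiplicative unit element. ''Isometrically isomorphic'' means by an isometric algebra isomorphism. *)

(* Defs.v *)
From HB Require Import structures.
From mathcomp Require Import all_boot all_order all_algebra.
From mathcomp Require Import all_classical all_reals all_analysis.

Set Implicit Arguments.
Unset Strict Implicit.
Unset Printing Implicit Defensive.

Import Order.TTheory GRing.Theory Num.Theory.
Import numFieldNormedType.Exports.

Local Open Scope classical_set_scope.
Local Open Scope ring_scope.

(* [set_type A] carries the subspace topology (the initial topology of the
   inclusion); the library's [subspace A] would instead keep the points outside
   [A] as isolated points. *)
Definition subsp (X : topologicalType) (A : set X) : topologicalType :=
  set_type A.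

Definition homeomorphic (X Y : topologicalType) : Prop :=
  exists (f : X -> Y) (g : Y -> X),
    [/\ continuous f, continuous g, cancel f g & cancel g f].

Definition embedding (X Y : topologicalType) (e : X -> Y) : Prop :=
  [/\ injective e, continuous e &
      forall U : set X, open U -> exists2 V : set Y, open V & U = e @^-1` V].

(* Separation axioms include Hausdorff; the library's [normal_space] and
   [completely_regular_space] do not. *)
Definition normal_hausdorff (X : topologicalType) : Prop :=
  hausdorff_space X /\ normal_space X.

Definition completely_regular (X : topologicalType) : Prop :=
  hausdorff_space X /\ completely_regular_space X.

Section topological_properties.
Variable P : topologicalType -> Prop.

Definition topological_property : Prop :=
  forall S T : topologicalType, homeomorphic S T -> P S -> P T.

Definition closed_hereditary : Prop :=
  forall (S : topologicalType) (A : set S), closed A -> P S -> P (subsp A).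

(* The union may be empty ([n = 0]), so the empty space has [P]. *)
Definition finite_closed_sums : Prop :=
  forall (S : topologicalType) (n : nat) (F : 'I_n -> set S),
    (forall i, closed (F i)) -> (forall i, P (subsp (F i))) ->
    \bigcup_i F i = [set: S] -> P S.

Definition locally_has (X : topologicalType) : Prop :=
  forall x : X, exists2 U : set X, nbhs x U & P (subsp U).

Definition null (X : topologicalType) : set (set X) :=
  [set A | P (subsp (closure A))].

Definition has_null_nbhd (X : topologicalType) (A : set X) : Prop :=
  exists2 U : set X, null U & A `<=` U°.

End topological_properties.

Section function_spaces.
Context {R : realType}.
Implicit Types X Y : topologicalType.

Definition Cb X : set (X -> R) :=
  [set f | continuous f /\ [bounded f x | x in [set: X]]].

Definition sup_norm X (f : X -> R) : R := sup [set `|f x| | x in [set: X]].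

Definition coz X (f : X -> R) : set X := ~` (f @^-1` [set 0]).

Definition supp X (f : X -> R) : set X := closure (coz f).

Definition Coz X : set (set X) :=
  [set C | exists2 f : X -> R, continuous f & C = coz f].

Definition C00 X : set (X -> R) := [set f | Cb f /\ compact (supp f)].

Definition C00P (P : topologicalType -> Prop) X : set (X -> R) :=
  [set f | Cb f /\ has_null_nbhd P (supp f)].

(* Not required to be proper. *)
Definition ideal_Cb X (H : set (X -> R)) : Prop :=
  [/\ H `<=` @Cb X, H 0, (forall f g, H f -> H g -> H (f + g)) &
      forall f h, Cb f -> H h -> H (f * h)].

Definition empty_hull X (H : set (X -> R)) : Prop :=
  forall x : X, exists2 h, H h & h x != 0.

Definition unital X (A : set (X -> R)) : Prop :=
  exists2 u, A u & forall f, A f -> u * f = f /\ f * u = f.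

(* A subalgebra of [Cb X], normed by [sup_norm]; the ring and module laws are
   those of the pointwise structure on [X -> R]. *)
Definition normed_algebra X (A : set (X -> R)) : Prop :=
  [/\ A `<=` @Cb X, A 0, (forall f g, A f -> A g -> A (f + g)),
      (forall (a : R) f, A f -> A (a *: f)) &
      (forall f g, A f -> A g -> A (f * g))] /\
  [/\ (forall f, A f -> 0 <= sup_norm f),
      (forall f, A f -> sup_norm f = 0 -> f = 0),
      (forall (a : R) f, A f -> sup_norm (a *: f) = `|a| * sup_norm f),
      (forall f g, A f -> A g -> sup_norm (f + g) <= sup_norm f + sup_norm g) &
      (forall f g, A f -> A g -> sup_norm (f * g) <= sup_norm f * sup_norm g)].

Definition isometrically_isomorphic X Y
    (A : set (X -> R)) (B : set (Y -> R)) : Prop :=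
  exists Phi : (X -> R) -> (Y -> R), set_bij A B Phi /\
    [/\ (forall f g, A f -> A g -> Phi (f + g) = Phi f + Phi g),
        (forall (a : R) f, A f -> Phi (a *: f) = a *: Phi f),
        (forall f g, A f -> A g -> Phi (f * g) = Phi f * Phi g) &
        (forall f, A f -> sup_norm (Phi f) = sup_norm f)].

End function_spaces.

Arguments Cb R X : clear implicits.
Arguments Coz R X : clear implicits.
Arguments C00 R X : clear implicits.
Arguments C00P R P X : clear implicits.

Section stone_cech.
Implicit Types X bX : topologicalType.

Definition compactification X bX (e : X -> bX) : Prop :=
  [/\ compact [set: bX], hausdorff_space bX, embedding e & dense (range e)].

(* [bX], with [X] identified with [range e], is the Stone-Cech compactification
   of [X]; it exists by [stone_cech_exists] below. *)
Definition stone_cech X bX (e : X -> bX) : Prop :=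
  compactification e /\
  forall (K : topologicalType) (f : X -> K),
    compact [set: K] -> hausdorff_space K -> continuous f ->
    exists2 F : bX -> K, continuous F & F \o e = f.

End stone_cech.

Definition lambdaP (R : realType) (P : topologicalType -> Prop)
    (X bX : topologicalType) (e : X -> bX) : set bX :=
  \bigcup_(C in [set C | Coz R X C /\ has_null_nbhd P (closure C)])
    (closure (e @` C))°.

Section stone_cech_existence.
Variable R : realType.

Let unit_fun (X : topologicalType) : set (X -> R) :=
  [set f : X -> R | continuous f /\ forall x, f x \in `[0, 1]].

Let cube (X : topologicalType) : topologicalType :=
  prod_topology (fun _ : unit_fun (X := X) => (R : topologicalType)).

Let coord (X : topologicalType) (f : unit_fun (X := X)) : X -> R := \val f.

Let coordP (X : topologicalType) (f : unit_fun (X := X)) :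
  continuous (coord f) /\ forall x, coord f x \in `[0, 1].
Proof. exact: (set_mem (valP f)). Qed.

Let ev (X : topologicalType) : X -> cube X := join_product (@coord X).

Let coord_sep (X : topologicalType) : completely_regular_space X ->
  separate_points_from_closed (@coord X).
Proof.
move=> crX U x cU nUx.
have /(@uniform_separatorP X R)[f [fc f01 f0 f1]] := crX _ _ cU nUx.
have Hf : f \in unit_fun (X := X).
  by apply/mem_set; split=> // y; apply: f01; exists y.
exists (exist _ f Hf); rewrite /coord /= => clx.
have : closure [set 1 : R] (f x) by apply: closureS clx.
have -> : f x = 0 by apply: f0; exists x.
have /closure_id <- : closed [set 1 : R].
  exact/accessible_closed_set1/hausdorff_accessible/Rhausdorff.
by move=> /= /eqP; rewrite eq_sym oner_eq0.
Qed.

Let ev_embedding (X : topologicalType) : completely_regular X ->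
  embedding (@ev X).
Proof.
move=> [hX crX]; have sep := coord_sep crX.
have cc f : continuous (@coord X f) by have [] := coordP f.
have inj : set_inj [set: X] (@ev X).
  exact: (join_product_inj sep (hausdorff_accessible hX)).
split.
- by move=> x y /inj; apply; rewrite inE.
- exact: (join_product_continuous sep cc).
- move=> U; rewrite (join_product_initial sep cc inj) => -[V oV <-].
  by exists V.
Qed.

Let cube_hausdorff X : hausdorff_space (cube X).
Proof. by apply: hausdorff_product => _; exact: Rhausdorff. Qed.

Let compact_closure_ev X : compact (closure (range (@ev X))).
Proof.
pose B : set (cube X) := [set y | forall f, y f \in `[(0 : R), 1]].
have cB : compact B.
  apply: (@tychonoff _ (fun=> (R : topologicalType))
    (fun=> [set` `[(0 : R), 1]])) => _.
  exact: segment_compact.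
apply: (subclosed_compact _ cB); first exact: closed_closure.
have /closure_id -> := compact_closed (@cube_hausdorff X) cB.
by apply: closureS => _ [x _ <-] f; have [_ +] := coordP f; exact.
Qed.

Let val_continuous (X : topologicalType) (A : set X) :
  continuous (\val : subsp A -> X).
Proof. exact: initial_continuous. Qed.

Let compact_subsp (X : topologicalType) (A : set X) :
  compact A -> compact [set: subsp A].
Proof.
move=> cA F PF _.
have FA : ((\val : subsp A -> X) @ F) A.
  by apply: (@filterE _ F) => x; exact: (set_mem (valP x)).
have [a [Aa cla]] := cA _ (fmap_proper_filter _ PF) FA.
exists (exist _ a (mem_set Aa)); split=> // S V FS [_ [[W oW <-] Wa WV]].
have [||_ [[x Sx <-] Wx]] := cla (\val @` S) W.
- by apply: (@filterS _ F) FS => x Sx; exists x.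
- exact: open_nbhs_nbhs.
- by exists x; split=> //; exact: WV.
Qed.

Let hausdorff_subsp (X : topologicalType) (A : set X) :
  hausdorff_space X -> hausdorff_space (subsp A).
Proof.
move=> hX x y cl; apply: val_inj; apply: hX => U V Ux Vy.
have [z [Uz Vz]] := cl _ _ (val_continuous Ux) (val_continuous Vy).
by exists (\val z).
Qed.

Let ptws_continuous (T V : topologicalType) (I : eqType)
    (h : T -> prod_topology (fun _ : I => V)) :
  (forall i, continuous (fun x => h x i)) -> continuous h.
Proof.
move=> hc x; apply/cvg_sup => i U [_ [[B oB <-] Bx BU]].
have nB : nbhs x (fun y => B (h y i)) by apply: hc; exact: open_nbhs_nbhs.
by apply: (@filterS _ (nbhs x) _ _ _ _ nB) => y; exact: BU.
Qed.

Let cube_map (X K : topologicalType) (f : X -> K) (fc : continuous f) :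
  exists2 h : cube X -> cube K, continuous h & forall x, h (ev x) = ev (f x).
Proof.
have H (g : unit_fun (X := K)) : (coord g \o f) \in unit_fun (X := X).
  apply/mem_set; have [gc g01] := coordP g; split=> [x|x]; last exact: g01.
  by apply: continuous_comp; [exact: fc | exact: gc].
pose idx g : unit_fun (X := X) := exist _ (coord g \o f) (H g).
pose h (y : cube X) : cube K := fun g => y (idx g).
exists h; last by move=> x; apply: functional_extensionality_dep.
apply: ptws_continuous => g y; exact: proj_continuous.
Qed.

Lemma stone_cech_exists (X : topologicalType) : completely_regular X ->
  exists (bX : topologicalType) (e : X -> bX), stone_cech e.
Proof.
move=> crX; have [evi evc evo] := ev_embedding crX.
set A := closure (range (@ev X)).
have Aev x : ev x \in A by apply/mem_set/subset_closure; exists x.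
pose e x : subsp A := exist _ (ev x) (Aev x).
exists (subsp A), e; split; first split.
- exact/compact_subsp/compact_closure_ev.
- exact/hausdorff_subsp/cube_hausdorff.
- split=> [x y /(congr1 \val)/evi //||U /evo[V oV ->]].
    apply/continuousP => _ [V oV <-]; rewrite -comp_preimage.
    by apply: open_comp oV => x _; exact: evc.
  by exists (\val @^-1` V) => //; exists V.
- move=> O [a Oa] [V oV VO].
  have Va : V (\val a) by rewrite -VO in Oa.
  have [_ [[x _ <-] Vx]] : range (@ev X) `&` V !=set0.
    by apply: (set_mem (valP a)); exact: open_nbhs_nbhs.
  by exists (e x); split; [rewrite -VO | exists x].
- move=> K f cK hK fc.
  have crK : completely_regular K.
    split=> //; apply: (@normal_completely_regular R).
      exact: compact_normal.
    exact: hausdorff_accessible.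
  have [Ki Kc Ko] := ev_embedding crK.
  have [h hc he] := cube_map fc.
  have clK : closed (range (@ev K)).
    apply: compact_closed; first exact: cube_hausdorff.
    by apply: continuous_compact cK; exact: continuous_subspaceT.
  have hA (y : subsp A) : range (@ev K) (h (\val y)).
    have cl : closed (h @^-1` range (@ev K)).
      by apply: preimage_closed clK => z _; exact: hc.
    move/closure_id: cl => cl; suff : (h @^-1` range (@ev K)) (\val y) by [].
    rewrite cl; move: (\val y) (set_mem (valP y)); apply: closureS => _ [x _ <-].
    by rewrite /preimage/= he; exists (f x).
  have {}hA (y : subsp A) : exists k, ev k = h (\val y).
    by have [k _ <-] := hA y; exists k.
  have [F FE] := choice hA.
  exists F; last first.
    by apply/funext => x /=; apply: Ki; rewrite FE /= he.
  apply/continuousP => U /Ko[V oV ->].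
  rewrite (_ : F @^-1` _ = \val @^-1` (h @^-1` V)).
    apply: open_comp; first by move=> y _; exact: val_continuous.
    by apply: open_comp oV => y _; exact: hc.
  by apply/seteqP; split=> y; rewrite /preimage/= FE.
Qed.

End stone_cech_existence.

(* Main.v *)
Require Import Defs.
From mathcomp Require Import all_boot all_order all_algebra.
From mathcomp Require Import all_classical all_reals all_analysis.
Import Order.TTheory GRing.Theory Num.Theory.
Import numFieldNormedType.Exports.
Local Open Scope classical_set_scope.
Local Open Scope ring_scope.

(** The heart of the theorem is the last part; the others rest on two remarks.
    Since [P] is inherited by closed subspaces and by finite closed unions, the
    sets with a null neighborhood form an ideal of sets, and since
    [supp (f + g)] and [supp (f * g)] are controlled by [supp f] and [supp g],
    the functions with support in that ideal form an ideal of functions.  And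
    as soon as this ideal has empty hull, the only candidate for a unit is the
    constant function one, whose support is the whole space.

    For normal and locally-[P] [X], let [bX] be the Stone-Cech compactification
    and [Y] its subspace [lambdaP R P e].  As a union of open sets of a compact
    Hausdorff space, [Y] is locally compact and Hausdorff; local null
    neighborhoods put [X] inside [Y] ([range_sub_lambdaP]), densely.  Restriction
    to [X] is then an isometric homomorphism from [C00 R Y] to bounded functions
    on [X], and its image is exactly [C00P R P X].  On the one hand a compact
    support is covered by finitely many of the open sets whose union is [Y], so
    its trace on [X] has a null neighborhood ([lambda_restrict_C00P]).  On the
    other hand a function in [C00P R P X] extends to [bX], and a Urysohn function
    shows that the closure in [bX] of its cozero-set is inside [Y], so that the
    extension has compact support on [Y] ([lambda_extend_C00]).  The same
    picture gives compactness: when [X] has [P], the constant one is in the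
    algebra and [Y] is all of [bX]; when [Y] is compact, the constant one is in
    [C00 R Y] and its restriction shows that [X] has [P].

    Uniqueness of [Y] is a Banach-Stone theorem: on a locally compact Hausdorff
    space every nonzero character of the algebra of functions with compact
    support is an evaluation ([C00_character]), so an isomorphism of two such
    algebras is composition with a map of the spaces, which is continuous
    because the cozero-sets are a basis ([C00_iso_homeomorphic]). *)

Set Implicit Arguments.
Unset Strict Implicit.

(** * Compactness, closures and subspaces *)

(** Finite subcovers, phrased as an induction principle.  If no member of [Q]
    contained [K], the traces on [K] of the complements of the members of [Q]
    would generate a proper filter without cluster point in [K]. *)
Lemma compact_directed (T : topologicalType) (K : set T) (Q : set (set T)) :
  compact K -> Q set0 -> setU_closed Q ->
  (forall x, K x -> exists2 V, Q V & nbhs x V) -> exists2 V, Q V & K `<=` V.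
Proof.
move=> cK Q0 QU Qloc; apply: contrapT => nQ.
pose F : set_system T := [set S | exists2 V, Q V & K `<=` V `|` S].
have FF : ProperFilter F.
  split=> [[V QV]|]; first by rewrite setU0 => KV; apply: nQ; exists V.
  split; first by exists set0 => //; rewrite setUT.
    move=> A B [V QV KVA] [W QW KWB]; exists (V `|` W); first exact: QU.
    move=> x Kx; have [|] := KVA x Kx; have [|] := KWB x Kx; by
      [left; right | left; left | right].
  move=> A B AB [V QV KVA]; exists V => // x /KVA[]; first by left.
  by move/AB; right.
have FK : F K by exists set0; rewrite ?set0U.
have [x [Kx clx]] := cK F FF FK; have [V QV xV] := Qloc x Kx.
have FV : F (~` V) by exists V => //; rewrite setUv.
by have [y [nVy Vy]] := clx _ _ FV xV.
Qed.

Lemma nbhs_dense (T : topologicalType) (A O : set T) (y : T) :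
  dense A -> nbhs y O -> O `&` A !=set0.
Proof.
move=> dA /nbhs_interior Oy; have [||x [Ox Ax]] := dA O°.
- by exists y; exact: nbhs_singleton.
- exact: open_interior.
- by exists x; split=> //; exact: interior_subset.
Qed.

Lemma normal_shrink (T : topologicalType) (A U : set T) :
  normal_space T -> closed A -> A `<=` U° ->
  exists2 V, closed V & A `<=` V° /\ V `<=` U°.
Proof.
move=> nT cA AU; have : set_nbhs A U°.
  by apply/set_nbhsP; exists U°; split=> //; exact: open_interior.
move=> /(nT A cA)[V AV clVU]; exists (closure V); first exact: closed_closure.
split=> // x Ax; have := AV _ Ax.
by apply: filterS; exact: subset_closure.
Qed.

Lemma regular_shrink (T : topologicalType) (x : T) (U : set T) :
  regular_space T -> nbhs x U ->
  exists2 V, closed V & nbhs x V /\ V `<=` U°.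
Proof.
move=> rT /nbhs_interior /(rT x)[V xV clVU].
exists (closure V); first exact: closed_closure.
by split=> //; apply: filterS xV; exact: subset_closure.
Qed.

Lemma normal_hausdorff_completely_regular (R : realType)
    (X : topologicalType) : normal_hausdorff X -> completely_regular X.
Proof.
move=> [hX nX]; split=> //; apply: (@normal_completely_regular R) => //.
exact: hausdorff_accessible.
Qed.

Section subspaces.
Variables (T : topologicalType) (A : set T).

(** The projection [val], typed so that continuity of maps into and out of
    [subsp A] can be stated. *)
Definition incl : subsp A -> T := val.

Lemma incl_continuous : continuous incl.
Proof. exact: initial_continuous. Qed.

Lemma incl_in (x : subsp A) : A (incl x).
Proof. exact: set_mem (valP x). Qed.

Lemma incl_inj : injective incl.
Proof. exact: val_inj. Qed.

Lemma subsp_lift (x : T) : A x -> exists y : subsp A, incl y = x.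
Proof. by move=> Ax; exists (exist _ x (mem_set Ax)). Qed.

Lemma nbhs_subsp (x : subsp A) (U : set (subsp A)) :
  nbhs x U <-> exists2 V, nbhs (incl x) V & incl @^-1` V `<=` U.
Proof.
split=> [[_ [[V oV <-] Vx VU]]|[V xV VU]].
  by exists V => //; exact: open_nbhs_nbhs.
exact: (@filterS _ (nbhs x) _ _ _ VU (incl_continuous xV)).
Qed.

Lemma continuous_subsp (S : topologicalType) (f : S -> subsp A) :
  continuous (incl \o f) -> continuous f.
Proof.
move=> cf x U /nbhs_subsp[V fV VU].
by apply: (@filterS _ (nbhs x) _ _ _ _ (cf x V fV)) => y; exact: VU.
Qed.

Lemma compact_incl_preimage (K : set T) :
  K `<=` A -> compact K -> compact (incl @^-1` K).
Proof.
move=> KA cK F PF FK.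
have [a [Ka cla]] := cK _ (fmap_proper_filter _ PF) FK.
have [y ya] := subsp_lift (KA _ Ka).
exists y; split=> [|S V FS /nbhs_subsp[W]]; first by rewrite /preimage /= ya.
rewrite ya => aW WV; have [|_ [[x Sx <-] Wx]] := cla (incl @` S) W _ aW.
  by apply: (@filterS _ F) FS => x Sx; exists x.
by exists x; split=> //; exact: WV.
Qed.

Lemma compact_subsp : compact A -> compact [set: subsp A].
Proof.
rewrite (_ : setT = incl @^-1` A); first exact: compact_incl_preimage.
by apply/seteqP; split=> // x _; exact: incl_in.
Qed.

Lemma compact_incl_image (K : set (subsp A)) :
  compact K -> compact (incl @` K).
Proof.
apply: continuous_compact; apply: continuous_subspaceT.
exact: incl_continuous.
Qed.

Lemma hausdorff_subsp : hausdorff_space T -> hausdorff_space (subsp A).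
Proof.
move=> hT x y cl; apply: incl_inj; apply: hT => U V Ux Vy.
have [z [Uz Vz]] := cl _ _ (incl_continuous Ux) (incl_continuous Vy).
by exists (incl z).
Qed.

End subspaces.

Lemma homeomorphic_subspT (T : topologicalType) :
  homeomorphic (subsp [set: T]) T.
Proof.
exists (@incl T setT), (fun x => exist _ x (mem_set I)); split=> //.
- exact: incl_continuous.
- by apply: continuous_subsp => x U.
- by move=> x; exact: incl_inj.
Qed.

Lemma homeomorphic_sym (S T : topologicalType) :
  homeomorphic S T -> homeomorphic T S.
Proof. by move=> [f [g [cf cg fK gK]]]; exists g, f. Qed.

Lemma homeomorphic_subsp_subsp (T : topologicalType) (A U : set T) :
  A `<=` U -> homeomorphic (subsp (@incl T U @^-1` A)) (subsp A).
Proof.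
move=> AU.
pose f (x : subsp (@incl T U @^-1` A)) : subsp A :=
  exist _ (incl (incl x)) (mem_set (incl_in x)).
pose g0 (x : subsp A) : subsp U := exist _ (incl x) (mem_set (AU _ (incl_in x))).
have g0A x : (@incl T U @^-1` A) (g0 x) := incl_in x.
exists f, (fun x => exist _ (g0 x) (mem_set (g0A x))); split.
- apply: continuous_subsp => x V xV.
  exact: (continuous_comp (@incl_continuous _ _ _) (@incl_continuous _ _ _)).
- apply: continuous_subsp; apply: continuous_subsp; exact: incl_continuous.
- by move=> x; apply: incl_inj; apply: incl_inj.
- by move=> x; apply: incl_inj.
Qed.

(** * Sets with a null neighborhood *)

Section null_sets.
Variable P : topologicalType -> Prop.
Hypotheses (P_top : topological_property P) (P_closed : closed_hereditary P).
Hypothesis P_sums : finite_closed_sums P.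
Variable X : topologicalType.
Implicit Types A B U V : set X.

Lemma subsp_closed_sub A U :
  closed A -> A `<=` U -> P (subsp U) -> P (subsp A).
Proof.
move=> cA AU PU; apply: (P_top (homeomorphic_subsp_subsp AU)).
apply: (P_closed _ PU); apply: preimage_closed cA => x _.
exact: incl_continuous.
Qed.

(** The empty union is among the finite closed sums. *)
Lemma subsp_set0 : P (subsp (@set0 X)).
Proof.
apply: (P_sums (F := fun _ : 'I_0 => set0)) => [[]|[]|] //.
by apply/seteqP; split=> // x; have := incl_in x.
Qed.

Lemma subsp_setU A B : closed A -> closed B ->
  P (subsp A) -> P (subsp B) -> P (subsp (A `|` B)).
Proof.
move=> cA cB PA PB; pose i := @incl X (A `|` B).
pose F (k : 'I_2) := i @^-1` (if k == ord0 then A else B).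
have ci D : closed D -> closed (i @^-1` D).
  by apply: preimage_closed => x _; exact: incl_continuous.
apply: (P_sums (F := F)) => [k|k|].
- by rewrite /F; case: ifP => _; exact: ci.
- rewrite /F; case: ifP => _.
    by apply: P_top PA; apply/homeomorphic_sym/homeomorphic_subsp_subsp; left.
  by apply: P_top PB; apply/homeomorphic_sym/homeomorphic_subsp_subsp; right.
- apply/seteqP; split=> // x _; have [Ax|Bx] := incl_in x.
    by exists ord0.
  by exists ord_max.
Qed.

Lemma has_null_nbhdP A : has_null_nbhd P A <->
  exists U, [/\ closed U, P (subsp U) & A `<=` U°].
Proof.
split=> [[U nU AU]|[U [cU PU AU]]].
  exists (closure U); split=> //; first exact: closed_closure.
  by apply: subset_trans AU _; exact/interiorS/subset_closure.
by exists U => //; rewrite /null /= -(closure_id U).1.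
Qed.

Lemma has_null_nbhd_sub A B :
  A `<=` B -> has_null_nbhd P B -> has_null_nbhd P A.
Proof. by move=> AB [U nU BU]; exists U => //; exact: subset_trans BU. Qed.

Lemma has_null_nbhd0 : has_null_nbhd P (@set0 X).
Proof.
apply/has_null_nbhdP; exists set0.
by split; [exact: closed0|exact: subsp_set0|exact: sub0set].
Qed.

Lemma has_null_nbhd_setU A B :
  has_null_nbhd P A -> has_null_nbhd P B -> has_null_nbhd P (A `|` B).
Proof.
move=> /has_null_nbhdP[U [cU PU AU]] /has_null_nbhdP[V [cV PV BV]].
apply/has_null_nbhdP; exists (U `|` V); split.
- exact: closedU.
- exact: subsp_setU.
- by apply: subset_trans (@interiorU _ _ _); exact: setUSS.
Qed.

Lemma has_null_nbhdT : has_null_nbhd P [set: X] <-> P X.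
Proof.
split=> [/has_null_nbhdP[U [_ PU TU]]|PX].
  have UT : U = setT.
    apply/seteqP; split=> // x _; apply: interior_subset; exact: TU.
  by move: PU; rewrite UT; apply: P_top; exact: homeomorphic_subspT.
apply/has_null_nbhdP; exists setT.
split; [exact: closedT| |by rewrite interiorT].
by apply: P_top PX; apply/homeomorphic_sym/homeomorphic_subspT.
Qed.

(** Two successive shrinkings: the first gives a closed neighborhood with [P], the
    second a closed set in its interior. *)
Lemma locally_has_null_nbhd : regular_space X -> locally_has P X ->
  forall x : X, exists2 V : set X, closed V & nbhs x V /\ has_null_nbhd P V.
Proof.
move=> rX lP x; have [U xU PU] := lP x.
have [W cW [xW WU]] := regular_shrink rX xU.
have [V cV [xV VW]] := regular_shrink rX xW.
exists V => //; split=> //; apply/has_null_nbhdP; exists W; split=> //.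
apply: subsp_closed_sub PU => //; apply: subset_trans WU _.
exact: interior_subset.
Qed.

End null_sets.

(** * Bounded continuous functions *)

Section bounded_functions.
Variables (R : realType) (X : topologicalType).
Implicit Types f g h : X -> R.

Lemma CbP f : Cb R X f <-> continuous f /\ exists M, forall x, `|f x| <= M.
Proof.
split=> -[cf]; last first.
  move=> [M fM]; split=> //; exists M; split; first exact: num_real.
  by move=> N MN x _; apply: le_trans (fM x) _; exact: ltW.
move=> [M [_ fM]]; split=> //; exists (M + 1) => x.
by apply: fM; rewrite ?ltrDl.
Qed.

Lemma Cb_cst (a : R) : Cb R X (cst a).
Proof. by apply/CbP; split; [exact: cst_continuous|exists `|a|]. Qed.

Lemma CbD f g : Cb R X f -> Cb R X g -> Cb R X (f + g).
Proof.
move=> /CbP[cf [M fM]] /CbP[cg [N gN]]; apply/CbP; split.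
  by move=> x; apply: continuousD; [exact: cf|exact: cg].
exists (M + N) => x; apply: le_trans (ler_normD _ _) _.
by apply: lerD; [exact: fM|exact: gN].
Qed.

Lemma CbM f g : Cb R X f -> Cb R X g -> Cb R X (f * g).
Proof.
move=> /CbP[cf [M fM]] /CbP[cg [N gN]]; apply/CbP; split.
  by move=> x; apply: continuousM; [exact: cf|exact: cg].
exists (M * N) => x; rewrite normrM.
by apply: ler_pM; rewrite ?normr_ge0 ?fM ?gN.
Qed.

Lemma scaler_cst_mul (a : R) f : a *: f = cst a * f.
Proof. by apply/funext. Qed.

Lemma CbZ (a : R) f : Cb R X f -> Cb R X (a *: f).
Proof. by rewrite scaler_cst_mul; apply: CbM; exact: Cb_cst. Qed.

Lemma le_sup_norm f x : Cb R X f -> `|f x| <= sup_norm f.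
Proof.
move=> /CbP[_ [M fM]]; apply: ub_le_sup; last by exists x.
by exists M => _ [y _ <-].
Qed.

Lemma sup_norm_le f (M : R) :
  0 <= M -> (forall x, `|f x| <= M) -> sup_norm f <= M.
Proof.
move=> M0 fM; rewrite /sup_norm; have [->|/set0P f0] := eqVneq
  [set `|f x| | x in [set: X]] set0; first by rewrite sup0.
by apply: ge_sup => // _ [x _ <-].
Qed.

Lemma sup_norm_ge0 f : Cb R X f -> 0 <= sup_norm f.
Proof.
move=> Cf; have [[x _]|nX] := pselect (exists x : X, True).
  by apply: le_trans (le_sup_norm x Cf).
rewrite /sup_norm (_ : [set _ | _ in _] = set0) ?sup0//.
by apply/seteqP; split=> // ? [x]; case: nX; exists x.
Qed.

Lemma sup_normZ_le (a : R) f :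
  Cb R X f -> sup_norm (a *: f) <= `|a| * sup_norm f.
Proof.
move=> Cf; apply: sup_norm_le => [|x].
  by rewrite mulr_ge0// sup_norm_ge0.
by rewrite [X in `|X|](_ : _ = a * f x)// normrM ler_wpM2l// le_sup_norm.
Qed.

Lemma normed_algebra_subCb (A : set (X -> R)) :
  A `<=` Cb R X -> A 0 -> (forall f g, A f -> A g -> A (f + g)) ->
  (forall (a : R) f, A f -> A (a *: f)) ->
  (forall f g, A f -> A g -> A (f * g)) -> normed_algebra A.
Proof.
move=> AC A0 AD AZ AM; split; split=> //.
- by move=> f /AC; exact: sup_norm_ge0.
- move=> f /AC Cf f0; apply/funext => x; apply/eqP.
  by rewrite -normr_le0 -f0; exact: le_sup_norm.
- move=> a f /AC Cf; apply/eqP; rewrite eq_le sup_normZ_le//=.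
  have [->|a0] := eqVneq a 0.
    by rewrite normr0 mul0r; apply/sup_norm_ge0/CbZ.
  have := sup_normZ_le a^-1 (CbZ a Cf); rewrite scalerA mulVf// scale1r normfV.
  by rewrite mulrC ler_pdivlMr ?normr_gt0// mulrC.
- move=> f g /AC Cf /AC Cg; apply: sup_norm_le => [|x].
    by rewrite addr_ge0// sup_norm_ge0.
  by apply: le_trans (ler_normD _ _) _; rewrite lerD// le_sup_norm.
- move=> f g /AC Cf /AC Cg; apply: sup_norm_le => [|x].
    by rewrite mulr_ge0// sup_norm_ge0.
  rewrite [X in `|X|](_ : _ = f x * g x)// normrM.
  by rewrite ler_pM// le_sup_norm.
Qed.

Lemma cozP f x : coz f x <-> f x != 0.
Proof. by split=> [/eqP|/eqP]. Qed.

Lemma coz_open f : continuous f -> open (coz f).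
Proof.
move=> cf; apply: closed_openC; apply: preimage_closed => [x _|].
  exact: cf.
exact/accessible_closed_set1/hausdorff_accessible/Rhausdorff.
Qed.

Lemma supp0 : supp (0 : X -> R) = set0.
Proof.
rewrite /supp (_ : coz _ = set0) ?closure0//.
by apply/seteqP; split=> // x /cozP; rewrite eqxx.
Qed.

Lemma suppD f g : supp (f + g) `<=` supp f `|` supp g.
Proof.
rewrite /supp -closureU; apply: closureS => x /cozP fg0.
have [f0|f0] := eqVneq (f x) 0; [right|left]; apply/cozP => //.
apply: contraNneq fg0 => g0.
by rewrite [X in X == _](_ : _ = f x + g x)// f0 g0 addr0.
Qed.

Lemma suppM f g : supp (f * g) `<=` supp g.
Proof.
apply: closureS => x /cozP fg0; apply/cozP; apply: contraNneq fg0 => g0.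
by rewrite [X in X == _](_ : _ = f x * g x)// g0 mulr0.
Qed.

(** As [V] is closed, it is enough that [f] vanishes off the interior of [V]; then
    the closure of the cozero-set is inside [V] too. *)
Lemma bump_function (x : X) (V : set X) :
  completely_regular_space X -> closed V -> nbhs x V ->
  exists f, [/\ Cb R X f, f x = 1 & supp f `<=` V].
Proof.
move=> crX cV xV.
have cC : closed (~` V°) by apply: open_closedC; exact: open_interior.
have /(crX x _ cC)/(@uniform_separatorP X R)[f [cf f01 f0 f1]] : ~ (~` V°) x.
  by move=> /(_ _); apply; exact: xV.
(* The separating function [f] is zero at [x] and one off the interior of [V]. *)
exists (cst 1 + - 1 *: f); split.
- apply: CbD; first exact: Cb_cst.
  apply: CbZ; apply/CbP; split=> //; exists 1 => y.
  have : `[0, 1]%classic (f y) by apply: f01; exists y.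
  by rewrite /= in_itv /= => /andP[fy0 fy1]; rewrite ger0_norm.
- rewrite [LHS](_ : _ = 1 + - 1 * f x)//.
  have -> : f x = 0 by apply: f0; exists x.
  by rewrite mulr0 addr0.
- have /closure_id -> := cV; apply: closureS => y /cozP fy.
  apply: interior_subset; apply: contrapT => nVy; move/eqP: fy; apply.
  rewrite [LHS](_ : _ = 1 + - 1 * f y)//.
  have -> : f y = 1 by apply: f1; exists y.
  by rewrite mulN1r subrr.
Qed.

Lemma normal_separating_function (A U : set X) :
  normal_space X -> closed A -> A `<=` U° ->
  exists f, [/\ Cb R X f, forall x, A x -> f x = 1 & coz f `<=` U].
Proof.
move=> nX cA AU.
have cC : closed (~` U°) by apply: open_closedC; exact: open_interior.
have dis : ~` U° `&` A = set0.
  by apply/seteqP; split=> // x [nUx /AU].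
have /(@uniform_separatorP X R)[f [cf f01 f0 f1]] :=
  (@normal_separatorP R X).1 nX _ _ cC cA dis.
exists f; split.
- apply/CbP; split=> //; exists 1 => y.
  have : `[0, 1]%classic (f y) by apply: f01; exists y.
  by rewrite /= in_itv /= => /andP[fy0 fy1]; rewrite ger0_norm.
- by move=> x Ax; apply: f1; exists x.
- move=> x /cozP/eqP fx; apply: interior_subset; apply: contrapT => nUx.
  by apply: fx; apply: f0; exists x.
Qed.

End bounded_functions.

(** * The algebra of functions with null-bounded support *)

Section null_support.
Variables (R : realType) (P : topologicalType -> Prop).
Hypotheses (P_top : topological_property P) (P_closed : closed_hereditary P).
Hypothesis P_sums : finite_closed_sums P.
Variable X : topologicalType.
Implicit Types f g h : X -> R.

Lemma C00P_ideal : ideal_Cb (C00P R P X).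
Proof.
split.
- by move=> f [].
- by split; [exact: Cb_cst|rewrite supp0; exact: has_null_nbhd0].
- move=> f g [Cf nf] [Cg ng]; split; first exact: CbD.
  by apply: has_null_nbhd_sub (@suppD _ _ _ _) _; exact: has_null_nbhd_setU.
- move=> f h Cf [Ch nh]; split; first exact: CbM.
  exact: has_null_nbhd_sub (@suppM _ _ _ _) nh.
Qed.

Lemma C00P_normed_algebra : normed_algebra (C00P R P X).
Proof.
have [HC H0 HD HM] := C00P_ideal.
apply: normed_algebra_subCb => // [a f Hf|f g Hf Hg].
  by rewrite scaler_cst_mul; apply: HM => //; exact: Cb_cst.
by apply: HM => //; exact: HC.
Qed.

Lemma C00P_closed_nbhd : C00P R P X =
  [set f | Cb R X f /\
     exists U : set X, [/\ closed U, P (subsp U) & supp f `<=` U°]].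
Proof. by apply/seteqP; split=> f [Cf /has_null_nbhdP]. Qed.

Lemma C00P_normal_nbhd : normal_hausdorff X -> C00P R P X =
  [set f | Cb R X f /\ exists U : set X, P (subsp U) /\ supp f `<=` U°].
Proof.
move=> [hX nX]; rewrite C00P_closed_nbhd; apply/seteqP; split=> f [Cf].
  by move=> [U [_ PU fU]]; split=> //; exists U.
move=> [U [PU fU]]; split=> //.
have [V cV [fV VU]] := normal_shrink nX (@closed_closure _ _) fU.
exists V; split=> //; apply: subsp_closed_sub PU => //.
by apply: subset_trans VU _; exact: interior_subset.
Qed.

Lemma C00P_empty_hull :
  completely_regular X -> empty_hull (C00P R P X) <-> locally_has P X.
Proof.
move=> [hX crX]; split=> [eh x|lP x].
  have [h [_ /has_null_nbhdP[U [cU PU hU]]] hx] := eh x.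
  by exists U => //; apply: hU; apply: subset_closure; exact/cozP.
have rX := @completely_regular_regular R _ crX.
have [V cV [xV nV]] := locally_has_null_nbhd P_top P_closed rX lP x.
have [f [Cf fx fV]] := bump_function R crX cV xV.
exists f; last by rewrite fx oner_neq0.
by split=> //; exact: has_null_nbhd_sub nV.
Qed.

Lemma C00P_cst1 : C00P R P X (cst 1) <-> P X.
Proof.
rewrite /C00P /= (_ : supp _ = setT).
  by rewrite has_null_nbhdT//; split=> [[]|PX] //; split=> //; exact: Cb_cst.
rewrite /supp (_ : coz _ = setT) ?closureT//.
by apply/seteqP; split=> // x _; apply/cozP; exact: oner_neq0.
Qed.

(** A unit takes the value one wherever some member does not vanish. *)
Lemma empty_hull_unit (A : set (X -> R)) u : empty_hull A ->
  (forall f, A f -> u * f = f /\ f * u = f) -> u = cst 1.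
Proof.
move=> eA uA; apply/funext => x; have [h Ah hx] := eA x.
have [/(congr1 (@^~ x)) uh _] := uA _ Ah.
by apply: (mulIf hx); rewrite [RHS]mul1r.
Qed.

Lemma C00P_unital : completely_regular X -> locally_has P X ->
  unital (C00P R P X) <-> P X.
Proof.
move=> crX lP; split=> [[u Au /empty_hull_unit]|PX].
  by move=> uE; apply/C00P_cst1; rewrite -uE//; exact/C00P_empty_hull.
exists (cst 1); first exact/C00P_cst1.
by move=> f _; split; apply/funext => x; [exact: mul1r|exact: mulr1].
Qed.

End null_support.

(** * Functions with compact support on a locally compact Hausdorff space *)

Lemma locally_compactTP (Y : topologicalType) : locally_compact [set: Y] <->
  forall y : Y, exists2 W : set Y, nbhs y W & compact W /\ closed W.
Proof.
split=> lY y => [|_].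
  have [W yW cW] := lY y I; exists W => //.
  by apply: (@filterS _ (nbhs y)) yW => z; exact.
have [W yW cW] := lY y; exists W => //.
by apply: (@filterS _ (nbhs y)) yW => z.
Qed.

Section compact_support.
Variables (R : realType) (Y : topologicalType).
Implicit Types f g h : Y -> R.

Lemma compact_supp_sub f (K : set Y) :
  compact K -> supp f `<=` K -> compact (supp f).
Proof. by apply: subclosed_compact; exact: closed_closure. Qed.

Lemma supp_eq0 f y : ~ supp f y -> f y = 0.
Proof.
by apply: contra_notP => /eqP fy; apply: subset_closure; exact/cozP.
Qed.

(** The bounds on open sets, of which finitely many cover the support, make [f]
    bounded. *)
Lemma C00_continuous f : continuous f -> compact (supp f) -> C00 R Y f.
Proof.
move=> cf Kf; split=> //; apply/CbP; split=> //.
have [|||V [M fM] fV] := compact_directed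
  (Q := [set V | exists M, forall y, V y -> `|f y| <= M]) Kf.
- by exists 0.
- move=> V W [M VM] [N WN]; exists (Num.max M N) => y.
  by rewrite le_max => -[/VM|/WN] ->; rewrite ?orbT.
- move=> y _; exists [set z | `|f z| <= `|f y| + 1].
    by exists (`|f y| + 1).
  have := cf y _ (nbhsx_ballx (f y) 1 ltr01).
  apply: (@filterS _ (nbhs y)) => z; rewrite /ball /= => yz.
  rewrite -(subrK (f y) (f z)) addrC; apply: le_trans (ler_normD _ _) _.
  by rewrite lerD2l distrC ltW.
exists (Num.max M 0) => y; rewrite le_max.
have [/fV/fM -> //|/supp_eq0 ->] := pselect (supp f y).
by rewrite normr0 lexx orbT.
Qed.

Lemma C00D f g : C00 R Y f -> C00 R Y g -> C00 R Y (f + g).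
Proof.
move=> [Cf Kf] [Cg Kg]; split; first exact: CbD.
by apply: compact_supp_sub (@suppD _ _ _ _); exact: compactU.
Qed.

Lemma C00_mull f g : Cb R Y f -> C00 R Y g -> C00 R Y (f * g).
Proof.
move=> Cf [Cg Kg]; split; first exact: CbM.
exact: compact_supp_sub (@suppM _ _ _ _).
Qed.

Lemma C00_normed_algebra : normed_algebra (C00 R Y).
Proof.
apply: normed_algebra_subCb.
- by move=> f [].
- by split; [exact: Cb_cst|rewrite supp0; exact: compact0].
- exact: C00D.
- by move=> a f; rewrite scaler_cst_mul; apply: C00_mull; exact: Cb_cst.
- by move=> f g [Cf _]; exact: C00_mull.
Qed.

Hypotheses (lY : locally_compact [set: Y]) (hY : hausdorff_space Y).

Lemma C00_bump (y : Y) (U : set Y) : nbhs y U ->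
  exists f, [/\ C00 R Y f, f y = 1 & supp f `<=` U].
Proof.
move=> yU; have crY := @locally_compact_completely_regular _ R lY hY.
have rY := @completely_regular_regular R _ crY.
have [V cV [yV VU]] := regular_shrink rY yU.
have [W yW [KW cW]] := (locally_compactTP Y).1 lY y.
have [f [Cf fy fVW]] := bump_function R crY (closedI cV cW) (filterI yV yW).
exists f; split=> //.
  by split=> //; apply: compact_supp_sub KW _ => z /fVW[].
by move=> z /fVW[/VU/interior_subset].
Qed.

Lemma C00_separates (x y : Y) : (forall f, C00 R Y f -> f x = f y) -> x = y.
Proof.
move=> fxy; apply: contrapT => /eqP xy.
have [U [oU /set_mem Ux /set_mem nUy]] := hausdorff_accessible hY xy.
have [|f [Cf fx fU]] := C00_bump (y := x) (U := U); first exact: open_nbhs_nbhs.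
have := fxy f Cf; rewrite fx supp_eq0 => [/eqP|/fU//].
by rewrite oner_eq0.
Qed.

(** Otherwise the kernel of [phi] contains, for each point, a function that does
    not vanish there, hence, adding squares, a function [h] that is positive on
    the compact support of any given [g].  Then [g / h], extended by zero, is
    continuous, and [g = h * (g / h)] is in the kernel as well. *)
Lemma C00_character (phi : (Y -> R) -> R) :
  (forall f g, C00 R Y f -> C00 R Y g -> phi (f + g) = phi f + phi g) ->
  (forall (a : R) f, C00 R Y f -> phi (a *: f) = a * phi f) ->
  (forall f g, C00 R Y f -> C00 R Y g -> phi (f * g) = phi f * phi g) ->
  (exists2 f, C00 R Y f & phi f != 0) ->
  exists y, forall f, C00 R Y f -> phi f = f y.
Proof.
move=> phiD phiZ phiM [g Cg /eqP phig]; apply: contrapT => nev; apply: phig.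
have [[_ C0 CD CZ CM] _] := C00_normed_algebra.
have ker y : exists k, [/\ C00 R Y k, phi k = 0 & k y != 0].
  have [f Cf phify] : exists2 f, C00 R Y f & phi f != f y.
    apply: contrapT => nf; apply: nev; exists y => f Cf; apply/eqP.
    by apply: contrapT => /negP phify; apply: nf; exists f.
  have [b [Cb1 b1 _]] := C00_bump (@filterT _ (nbhs y) _).
  (* This is [b * (f - phi f)], whose image is [phi b * phi f - phi f * phi b]. *)
  exists (b * f + - phi f *: b); split.
  - by apply: CD; [exact: CM|exact: CZ].
  - rewrite phiD; [|exact: CM|exact: CZ].
    by rewrite phiM// phiZ// mulrC mulNr subrr.
  - rewrite [X in X != _](_ : _ = b y * f y + - phi f * b y)// b1 mul1r mulr1.
    by rewrite subr_eq0 eq_sym.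
have [|||V [h [Ch phih h0 hV]] gV] := compact_directed
  (Q := [set V | exists h, [/\ C00 R Y h, phi h = 0, forall y, 0 <= h y &
                               forall y, V y -> 0 < h y]]) Cg.2.
- exists 0; split=> //.
  by rewrite -(scale0r (0 : Y -> R)) phiZ// mul0r.
- move=> V W [h [Ch phih h0 hV]] [k [Ck phik k0 kW]]; exists (h + k); split.
  + exact: CD.
  + by rewrite phiD// phih phik addr0.
  + by move=> y; exact: addr_ge0.
  + by move=> y [/hV hy|/kW ky]; [exact: ltr_wpDr|exact: ltr_wpDl].
- move=> y _; have [k [Ck phik ky]] := ker y; exists (coz k).
    exists (k * k); split.
    + exact: CM.
    + by rewrite phiM// phik mul0r.
    + by move=> z; rewrite -[X in _ <= X]/(k z * k z) -expr2 sqr_ge0.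
    + move=> z /cozP kz; rewrite -[X in _ < X]/(k z * k z) -expr2.
      by rewrite exprn_even_gt0.
  apply: open_nbhs_nbhs; split; last exact/cozP.
  by apply: coz_open; case: Ck => -[].
have [[[cg _] Kg] [[ch _] _]] := (Cg, Ch).
(* Off the support of [g] the numerator is zero, whatever the inverse is. *)
pose q y := g y * (h y)^-1.
have Kq : supp q `<=` supp g.
  apply: closureS => y /cozP qy; apply/cozP; apply: contraNneq qy => gy.
  by rewrite /q gy mul0r.
have Cq : C00 R Y q.
  apply: C00_continuous; last exact: compact_supp_sub Kq.
  move=> y; have [gy|ngy] := pselect (supp g y).
    apply: (@continuousM _ _ g (fun y => (h y)^-1)); first exact: cg.
    by apply: continuousV; [apply: lt0r_neq0; exact/hV/gV|exact: ch].
  have : \forall z \near y, q z = 0.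
    have : nbhs y (~` supp g).
      apply: open_nbhs_nbhs; split=> //.
      by apply: closed_openC; exact: closed_closure.
    apply: (@filterS _ (nbhs y)) => z gz.
    by apply: supp_eq0 => /Kq.
  move=> qz; rewrite /continuous_at (nbhs_singleton qz).
  by apply: cvg_near_cst.
have -> : g = h * q.
  apply/funext => y; rewrite [RHS](_ : _ = h y * (g y * (h y)^-1))//.
  have [/gV/hV hy|/supp_eq0 ->] := pselect (supp g y);
    last by rewrite mul0r mulr0.
  by rewrite mulrCA divff ?mulr1// lt0r_neq0.
by rewrite phiM// phih mul0r.
Qed.

End compact_support.

(** * Isometric isomorphisms *)

Section isomorphisms.
Variable R : realType.

(** Names the map that [isometrically_isomorphic] only asserts to exist. *)
Definition isometric_isomorphism (X Y : topologicalType) (A : set (X -> R))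
    (B : set (Y -> R)) (Phi : (X -> R) -> (Y -> R)) : Prop :=
  set_bij A B Phi /\
    [/\ (forall f g, A f -> A g -> Phi (f + g) = Phi f + Phi g),
        (forall (a : R) f, A f -> Phi (a *: f) = a *: Phi f),
        (forall f g, A f -> A g -> Phi (f * g) = Phi f * Phi g) &
        (forall f, A f -> sup_norm (Phi f) = sup_norm f)].

Lemma isometric_isomorphism_inverse (X Y : topologicalType)
    (A : set (X -> R)) (B : set (Y -> R)) Phi :
  normed_algebra A -> isometric_isomorphism A B Phi ->
  exists2 Psi, isometric_isomorphism B A Psi &
    forall g, B g -> Phi (Psi g) = g.
Proof.
move=> [[_ A0 AD AZ AM] _] [[AB inj surj] [PhiD PhiZ PhiM PhiN]].
have /choice[Psi PsiP] g : exists f, B g -> A f /\ Phi f = g.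
  have [/surj[f Af fg]|nB] := pselect (B g); first by exists f.
  by exists 0.
have PsiA g : B g -> A (Psi g) by move=> /PsiP[].
have PsiK g : B g -> Phi (Psi g) = g by move=> /PsiP[].
have PsiE f g : A f -> Phi f = g -> Psi g = f.
  move=> Af fg; have Bg : B g by rewrite -fg; exact: AB.
  by apply: inj; rewrite ?inE ?PsiK//; exact: PsiA.
exists Psi => //; split; first split.
- by move=> g /PsiA.
- by move=> g h /set_mem Bg /set_mem Bh /(congr1 Phi); rewrite !PsiK.
- by move=> f Af; exists (Phi f); [exact: AB|exact: PsiE].
split.
- move=> g h Bg Bh; apply: PsiE; first by apply: AD; exact: PsiA.
  by rewrite PhiD ?PsiK//; exact: PsiA.
- move=> a g Bg; apply: PsiE; first by apply: AZ; exact: PsiA.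
  by rewrite PhiZ ?PsiK//; exact: PsiA.
- move=> g h Bg Bh; apply: PsiE; first by apply: AM; exact: PsiA.
  by rewrite PhiM ?PsiK//; exact: PsiA.
- by move=> g Bg; rewrite -PhiN ?PsiK//; exact: PsiA.
Qed.

Lemma isometrically_isomorphic_sym (X Y : topologicalType)
    (A : set (X -> R)) (B : set (Y -> R)) :
  normed_algebra A -> isometrically_isomorphic A B ->
  isometrically_isomorphic B A.
Proof.
move=> nA [Phi isoPhi].
by have [Psi isoPsi _] := isometric_isomorphism_inverse nA isoPhi; exists Psi.
Qed.

Lemma isometrically_isomorphic_trans (X Y Z : topologicalType)
    (A : set (X -> R)) (B : set (Y -> R)) (C : set (Z -> R)) :
  isometrically_isomorphic A B -> isometrically_isomorphic B C ->
  isometrically_isomorphic A C.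
Proof.
move=> [Phi [[AB injPhi surjPhi] [PhiD PhiZ PhiM PhiN]]].
move=> [Psi [[BC injPsi surjPsi] [PsiD PsiZ PsiM PsiN]]].
exists (Psi \o Phi); split; first split.
- by move=> f /AB/BC.
- move=> f g Af Ag /injPsi fg; apply: injPhi => //.
  by apply: fg; rewrite inE; apply: AB; exact: set_mem.
- by move=> h /surjPsi[g /surjPhi[f Af <-] <-]; exists f.
split=> /=.
- by move=> f g Af Ag; rewrite PhiD// PsiD//; exact: AB.
- by move=> a f Af; rewrite PhiZ// PsiZ//; exact: AB.
- by move=> f g Af Ag; rewrite PhiM// PsiM//; exact: AB.
- by move=> f Af; rewrite PsiN ?PhiN//; exact: AB.
Qed.

Section compact_support_isomorphisms.
Variables Y Z : topologicalType.
Hypotheses (lY : locally_compact [set: Y]) (hY : hausdorff_space Y).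
Hypotheses (lZ : locally_compact [set: Z]) (hZ : hausdorff_space Z).

(** Composing evaluation at [z] with [Phi] is a character, hence evaluation at
    a point [s z]; the cozero sets of [C00] being a basis, [s] is continuous. *)
Lemma C00_iso_pullback Phi : isometric_isomorphism (C00 R Y) (C00 R Z) Phi ->
  exists2 s : Z -> Y, continuous s &
    forall f z, C00 R Y f -> Phi f z = f (s z).
Proof.
move=> [[YZ inj surj] [PhiD PhiZ PhiM _]].
have /choice[s sP] z : exists y, forall f, C00 R Y f -> Phi f z = f y.
  apply: (C00_character lY hY (phi := fun f => Phi f z)).
  - by move=> f g Cf Cg; rewrite PhiD.
  - by move=> a f Cf; rewrite PhiZ.
  - by move=> f g Cf Cg; rewrite PhiM.
  - have [b [Cb1 b1 _]] := C00_bump R lZ hZ (@filterT _ (nbhs z) _).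
    by have [f Cf fb] := surj _ Cb1; exists f; rewrite // fb b1 oner_neq0.
exists s; last by move=> f z; exact: sP.
move=> z U sU; have [f [Cf fz fU]] := C00_bump R lY hY sU.
have : nbhs z (coz (Phi f)).
  apply: open_nbhs_nbhs; split; last by apply/cozP; rewrite sP// fz oner_neq0.
  by apply: coz_open; have [[]] := YZ _ Cf.
apply: (@filterS _ (nbhs z)) => x /cozP; rewrite sP// => fx.
by apply: fU; apply: subset_closure; exact/cozP.
Qed.

End compact_support_isomorphisms.

(** The pullbacks along an isomorphism and along its inverse are mutually inverse
    because functions with compact support separate points. *)
Lemma C00_iso_homeomorphic (Y Z : topologicalType) :
  locally_compact [set: Y] -> hausdorff_space Y ->
  locally_compact [set: Z] -> hausdorff_space Z ->
  isometrically_isomorphic (C00 R Y) (C00 R Z) -> homeomorphic Y Z.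
Proof.
move=> lY hY lZ hZ [Phi isoPhi].
have [s cs sP] := C00_iso_pullback lY hY lZ hZ isoPhi.
have [Psi isoPsi PhiK] :=
  isometric_isomorphism_inverse (C00_normed_algebra R Y) isoPhi.
have [t ct tP] := C00_iso_pullback lZ hZ lY hY isoPsi.
have [[PsiC _ _] _] := isoPsi; have [[PhiC PhiI _] _] := isoPhi.
exists t, s; split=> // [y|z].
  apply: (C00_separates (R := R) lY hY) => f Cf; have Cg := PhiC _ Cf.
  rewrite -sP// -tP//; congr (_ y); apply: PhiI; rewrite ?inE ?PhiK//.
  exact: PsiC.
apply: (C00_separates (R := R) lZ hZ) => g Cg.
by rewrite -tP// -sP ?PhiK//; exact: PsiC.
Qed.

End isomorphisms.

(** * Dense embeddings and the Stone-Cech compactification *)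

Lemma dense_sub_closed (T : topologicalType) (A D : set T) :
  dense A -> closed D -> A `<=` D -> forall x, D x.
Proof.
move=> dA cD AD x; apply: cD => O xO.
by have [y [Oy Ay]] := nbhs_dense dA xO; exists y; split=> //; exact: AD.
Qed.

Lemma embedding_preimage_closure (X T : topologicalType) (e : X -> T)
    (C : set X) : embedding e -> e @^-1` closure (e @` C) `<=` closure C.
Proof.
move=> [_ _ eo] x clx U /nbhs_interior xU.
have [V oV UV] := eo _ (open_interior U).
have [|_ [[y Cy <-] Vy]] := clx V.
  apply: open_nbhs_nbhs; split=> //; rewrite -[V (e x)]/((e @^-1` V) x) -UV.
  exact: nbhs_singleton.
exists y; split=> //; apply: interior_subset; rewrite UV; exact: Vy.
Qed.

Lemma locally_compact_open (T : topologicalType) (O : set T) :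
  compact [set: T] -> hausdorff_space T -> open O ->
  locally_compact [set: subsp O].
Proof.
move=> cT hT oO; apply/locally_compactTP => y.
have yO : nbhs (incl y) O by apply: open_nbhs_nbhs; split=> //; exact: incl_in.
have rT : {for incl y, @regular_space T}.
  by apply: compact_regular cT _ => //; exact: filterT.
have [V yV clVO] := rT _ yO.
exists (@incl T O @^-1` closure V).
  apply: incl_continuous; apply: filterS yV; exact: subset_closure.
split; last first.
  apply: preimage_closed (@closed_closure _ _) => x _; exact: incl_continuous.
apply: compact_incl_preimage => //.
exact: subclosed_compact (@closed_closure _ _) cT _.
Qed.

Section dense_restriction.
Variables (R : realType) (X Y : topologicalType) (i : X -> Y).
Hypotheses (ic : continuous i) (di : dense (range i)).
Implicit Types k l : Y -> R.

Lemma Cb_comp k : Cb R Y k -> Cb R X (k \o i).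
Proof.
move=> /CbP[ck [M kM]]; apply/CbP; split; last by exists M => x; exact: kM.
by move=> x; apply: continuous_comp; [exact: ic|exact: ck].
Qed.

Lemma sup_norm_dense k : Cb R Y k -> sup_norm (k \o i) = sup_norm k.
Proof.
move=> Ck; have Cki := Cb_comp Ck; apply/eqP; rewrite eq_le; apply/andP; split.
  apply: sup_norm_le => [|x]; first exact: sup_norm_ge0.
  exact: (le_sup_norm (i x) Ck).
apply: sup_norm_le => [|y]; first exact: sup_norm_ge0.
pose D := (fun y => `|k y|) @^-1` [set r | r <= sup_norm (k \o i)].
suff : D y by [].
apply: (dense_sub_closed di) => [|_ [x _ <-]]; last exact: (le_sup_norm x Cki).
apply: preimage_closed; last exact: closed_le.
move=> z _; apply: continuous_comp.
  by case: Ck => + _; exact.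
exact: norm_continuous.
Qed.

Lemma dense_ext_eq k l : continuous k -> continuous l ->
  k \o i = l \o i -> k = l.
Proof.
move=> ck cl kl; apply/funext => y; apply/eqP; rewrite -subr_eq0; apply/eqP.
pose D := (k - l) @^-1` [set 0].
suff : D y by [].
apply: (dense_sub_closed di) => [|_ [x _ <-]].
  apply: preimage_closed => [z _|].
    by apply: continuousB; [exact: ck|exact: cl].
  exact/accessible_closed_set1/hausdorff_accessible/Rhausdorff.
apply/eqP; rewrite subr_eq0; apply/eqP.
exact: (congr1 (@^~ x) kl).
Qed.

(** As [range i] is dense, a point where [k] does not vanish is a limit of
    points [i x] where [k] does not vanish either. *)
Lemma coz_sub_closure k :
  continuous k -> coz k `<=` (closure (i @` coz (k \o i)))°.
Proof.
move=> ck; rewrite -open_subsetE; last exact: coz_open.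
move=> y ky O yO.
have kO : nbhs y (O `&` coz k).
  by apply: filterI => //; apply: open_nbhs_nbhs; split=> //; exact: coz_open.
have [z [[Oz kz] [x _ xz]]] := nbhs_dense di kO.
by exists z; split=> //; exists x; rewrite // /coz /= xz.
Qed.

End dense_restriction.

(** A bounded function maps into a closed interval, to which the universal
    property applies. *)
Lemma stone_cech_extension (R : realType) (X bX : topologicalType)
    (e : X -> bX) (f : X -> R) : stone_cech e -> Cb R X f ->
  exists2 F : bX -> R, continuous F & F \o e = f.
Proof.
move=> [_ ext] /CbP[cf [M fM]].
pose K : set R := [set` `[- M, M]].
have fK x : K (f x) by rewrite /K /= in_itv /= -ler_norml.
pose f0 x : subsp K := exist _ (f x) (mem_set (fK x)).
have cf0 : continuous f0 by exact: continuous_subsp.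
have [||G cG Gf] := ext (subsp K) f0 _ _ cf0.
- by apply: compact_subsp; exact: segment_compact.
- by apply: hausdorff_subsp; exact: Rhausdorff.
exists (@incl _ K \o G).
  by move=> y; apply: continuous_comp; [exact: cG|exact: incl_continuous].
by rewrite -compA Gf.
Qed.

(** * The subspace [lambdaP] of the Stone-Cech compactification *)

Section lambda_space.
Variables (R : realType) (P : topologicalType -> Prop).
Hypotheses (P_top : topological_property P) (P_closed : closed_hereditary P).
Hypothesis P_sums : finite_closed_sums P.
Variables (X bX : topologicalType) (e : X -> bX).
Hypotheses (nX : normal_hausdorff X) (lP : locally_has P X).
Hypothesis SC : stone_cech e.

Let L : set bX := lambdaP R P e.
Let Y : topologicalType := subsp L.

Let bX_compact : compact [set: bX]. Proof. by case: SC => -[]. Qed.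
Let bX_hausdorff : hausdorff_space bX. Proof. by case: SC => -[]. Qed.
Let e_embedding : embedding e. Proof. by case: SC => -[]. Qed.
Let e_dense : dense (range e). Proof. by case: SC => -[]. Qed.
Let e_continuous : continuous e. Proof. by case: e_embedding. Qed.

Lemma lambdaP_open : open L.
Proof. by apply: bigcup_open => C _; exact: open_interior. Qed.

(** By density [coz G] is in the interior of the closure of its trace on [X], and
    this trace is one of the cozero-sets that define [L]. *)
Lemma coz_ext_sub_lambdaP (G : bX -> R) : continuous G ->
  has_null_nbhd P (supp (G \o e)) -> coz G `<=` L.
Proof.
move=> cG nG y /(coz_sub_closure e_dense cG) Gy.
exists (coz (G \o e)) => //; split=> //; exists (G \o e) => // x.
by apply: continuous_comp; [exact: e_continuous|exact: cG].
Qed.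

Lemma range_sub_lambdaP x : L (e x).
Proof.
have [hX crX] := normal_hausdorff_completely_regular R nX.
have rX := @completely_regular_regular R _ crX.
have [V cV [xV nV]] := locally_has_null_nbhd P_top P_closed rX lP x.
have [f [Cf fx fV]] := bump_function R crX cV xV.
have [F cF Ff] := stone_cech_extension SC Cf.
apply: (coz_ext_sub_lambdaP cF); first by
  rewrite Ff; exact: has_null_nbhd_sub nV.
by apply/cozP; rewrite -[F (e x)]/((F \o e) x) Ff fx oner_neq0.
Qed.

Definition lambda_embed (x : X) : Y :=
  exist _ (e x) (mem_set (range_sub_lambdaP x)).
Local Notation i := lambda_embed.

Lemma lambda_embed_embedding : embedding i.
Proof.
have [ei ec eo] := e_embedding; split.
- by move=> x y /(congr1 (@incl _ L))/ei.
- exact: continuous_subsp.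
- move=> U /eo[V oV UV]; exists (@incl _ L @^-1` V) => //.
  by apply: open_comp oV => y _; exact: incl_continuous.
Qed.

Lemma lambda_embed_dense : dense (range i).
Proof.
move=> O [y Oy] [V oV VO]; move: Oy; rewrite -VO => Vy.
have [||z [[Vz _] [x _ xz]]] := e_dense (O := V `&` L).
- by exists (incl y); split; [exact: Vy|exact: incl_in].
- by apply: openI => //; exact: lambdaP_open.
- by exists (i x); split; [rewrite -xz in Vz|exists x].
Qed.

Let i_continuous : continuous i. Proof. by case: lambda_embed_embedding. Qed.

(** Finitely many of the open sets whose union is [L] cover the compact support of
    [k], and the trace on [X] of each has a null neighborhood. *)
Lemma lambda_restrict_C00P (k : Y -> R) : C00 R Y k -> C00P R P X (k \o i).
Proof.
move=> [Ck Kk]; split; first exact: Cb_comp.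
have [|||V nV KV] := compact_directed
  (Q := [set V | has_null_nbhd P (e @^-1` V)]) (compact_incl_image Kk).
- by rewrite /= preimage_set0; exact: has_null_nbhd0.
- by move=> V W nV nW; rewrite /= preimage_setU; exact: has_null_nbhd_setU.
- move=> _ [y _ <-]; have [C [_ nC] yC] := incl_in y.
  exists (closure (e @` C)) => //; apply: has_null_nbhd_sub nC.
  exact: embedding_preimage_closure.
apply: has_null_nbhd_sub nV => x kx; apply: KV; exists (i x) => //.
have ci : closed (i @^-1` supp k).
  by apply: preimage_closed (@closed_closure _ _) => z _; exact: i_continuous.
by apply: ci; move: kx; apply: closureS => z kz; exact: subset_closure.
Qed.

(** Take [k] to be the restriction of an extension [F] of [f] to [bX].  By
    normality some [g] is one on the support of [f] and has itself a support with
    a null neighborhood.  Its extension [G] is one on the closure [K] in [bX] of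
    [coz f], so that [K] is inside [L]; and [K] is compact and contains the
    cozero-set of [F]. *)
Lemma lambda_extend_C00 (f : X -> R) : C00P R P X f ->
  exists2 k, C00 R Y k & k \o i = f.
Proof.
move=> [Cf /has_null_nbhdP[U [cU PU fU]]].
have [hX n_X] := nX.
have [V cV [fV VU]] := normal_shrink n_X (@closed_closure _ _) fU.
have [g [Cg g1 gV]] := normal_separating_function R n_X (@closed_closure _ _) fV.
have [F cF Ff] := stone_cech_extension SC Cf.
have [G cG Gg] := stone_cech_extension SC Cg.
have nG : has_null_nbhd P (supp (G \o e)).
  apply/has_null_nbhdP; exists U; split=> //; apply: subset_trans VU.
  by rewrite Gg; have /closure_id -> := cV; exact: closureS.
pose K := closure (e @` coz f).
have G1 : K `<=` G @^-1` [set 1].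
  have cG1 : closed (G @^-1` [set 1]).
    apply: preimage_closed => [y _|]; first exact: cG.
    exact/accessible_closed_set1/hausdorff_accessible/Rhausdorff.
  have /closure_id -> := cG1; apply: closureS => _ [x fx <-].
  rewrite /preimage /= -[G (e x)]/((G \o e) x) Gg; apply: g1.
  exact: subset_closure.
have KL : K `<=` L.
  move=> y /G1 Gy; apply: (coz_ext_sub_lambdaP cG nG); apply/cozP.
  by rewrite Gy oner_neq0.
have ck : continuous (F \o @incl _ L).
  by move=> y; apply: continuous_comp; [exact: incl_continuous|exact: cF].
exists (F \o @incl _ L); last by rewrite -Ff.
apply: C00_continuous => //; apply: (@compact_supp_sub _ _ _ (@incl _ L @^-1` K)).
  apply: compact_incl_preimage => //.
  exact: subclosed_compact (@closed_closure _ _) bX_compact _.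
have cK : closed (@incl _ L @^-1` K).
  by apply: preimage_closed (@closed_closure _ _) => y _; exact: incl_continuous.
have /closure_id -> := cK; apply: closureS => y Fy.
by have /interior_subset := coz_sub_closure e_dense cF Fy; rewrite Ff.
Qed.

Lemma C00P_isometrically_isomorphic :
  isometrically_isomorphic (C00P R P X) (C00 R Y).
Proof.
apply: isometrically_isomorphic_sym (C00_normed_algebra R Y) _.
exists (fun k => k \o i); split; first split.
- exact: lambda_restrict_C00P.
- move=> k l /set_mem[[ck _] _] /set_mem[[cl _] _].
  by move=> /= kl; exact: (dense_ext_eq lambda_embed_dense ck cl kl).
- by move=> f /lambda_extend_C00[k Ck kf]; exists k.
split=> //.
by move=> k [Ck _]; apply: sup_norm_dense => //; exact: lambda_embed_dense.
Qed.

Lemma lambdaP_locally_compact : locally_compact [set: Y].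
Proof. by apply: locally_compact_open => //; exact: lambdaP_open. Qed.

Lemma lambdaP_hausdorff : hausdorff_space Y.
Proof. exact: hausdorff_subsp. Qed.

Lemma lambdaP_compact : P X <-> compact [set: Y].
Proof.
split=> [PX|cY].
  suff LT : L = setT by apply: compact_subsp; rewrite LT.
  apply/seteqP; split=> // y _.
  apply: (coz_ext_sub_lambdaP (G := cst 1)); first exact: cst_continuous.
    by have [_] := (C00P_cst1 R P_top X).2 PX.
  by apply/cozP; exact: oner_neq0.
apply/(C00P_cst1 R P_top); apply: (lambda_restrict_C00P (k := cst 1)).
by split; [exact: Cb_cst|exact: compact_supp_sub cY _].
Qed.

End lambda_space.

Theorem theorem7p8 (R : realType) (P : topologicalType -> Prop)
    (P_top : topological_property P) (P_closed : closed_hereditary P)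
    (P_sums : finite_closed_sums P) (X : topologicalType) :
  (C00P R P X =
     [set f | Cb R X f /\
        exists U : set X, [/\ closed U, P (subsp U) & supp f `<=` U°]])
  /\ (normal_hausdorff X ->
      C00P R P X =
        [set f | Cb R X f /\
           exists U : set X, P (subsp U) /\ supp f `<=` U°])
  /\ ideal_Cb (C00P R P X)
  /\ (completely_regular X ->
      empty_hull (C00P R P X) <-> locally_has P X)
  /\ (completely_regular X -> locally_has P X ->
      unital (C00P R P X) <-> P X)
  /\ (normal_hausdorff X -> locally_has P X ->
      forall (bX : topologicalType) (e : X -> bX), stone_cech e ->
      let Y := subsp (lambdaP R P e) in
      [/\ normed_algebra (C00P R P X),
          [/\ locally_compact [set: Y], hausdorff_space Y &
              isometrically_isomorphic
                (C00P R P X) (C00 R Y)],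
          (forall Z : topologicalType,
             locally_compact [set: Z] -> hausdorff_space Z ->
             isometrically_isomorphic
               (C00P R P X) (C00 R Z) ->
             homeomorphic Z Y),
          (exists i : X -> Y,
             [/\ forall x, val (i x) = e x, embedding i & dense (range i)]) &
          (unital (C00P R P X) <-> P X) /\
          (P X <-> compact [set: Y])]).
Proof.
split; first exact: C00P_closed_nbhd.
split; first exact: C00P_normal_nbhd.
split; first exact: C00P_ideal.
split; first exact: C00P_empty_hull.
split; first exact: C00P_unital.
move=> nX lP bX e SC Y.
have lY : locally_compact [set: Y] by exact: lambdaP_locally_compact.
have hY : hausdorff_space Y by exact: lambdaP_hausdorff.
have nA : normed_algebra (C00P R P X) by exact: C00P_normed_algebra.
have isoY : isometrically_isomorphic (C00P R P X) (C00 R Y).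
  exact: C00P_isometrically_isomorphic.
split=> //.
- move=> Z lZ hZ isoZ; apply: (@C00_iso_homeomorphic R) => //.
  apply: isometrically_isomorphic_trans isoY.
  exact: isometrically_isomorphic_sym.
- exists (lambda_embed R P_top P_closed nX lP SC); split=> //.
    exact: lambda_embed_embedding.
  exact: lambda_embed_dense.
- split; last exact: lambdaP_compact.
  apply: C00P_unital => //; exact: normal_hausdorff_completely_regular R _ nX.
Qed.
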